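(* Let $\boldsymbol{k}=(k_1,\dots,k_r)$ be an index with $r\geqslant1$ and let $N\geqslant1$ be an integer. For $s\in\mathbb C\setminus\mathbb Z$, one has $$\mathcal T_N(\boldsymbol{k};s)=\sum_{j=1}^r\sum_{m_j=0}^{k_j-1}\sum_{-N<n_j<N}\left(\sum_{\substack{a+b=m_j\\ a,b\geqslant0}}\zeta_{(-N-n_j,0),a}\bigl(\boldsymbol{k}_{[1,j)}\bigr)\,\zeta_{(0,N-n_j),b}\bigl(\boldsymbol{k}_{(j,r]}\bigr)\right)\frac{1}{(n_j+s)^{k_j-m_j}}.$$
   Context: An index is a finite sequence $\boldsymbol{k}=(k_1,\dots,k_r)$ of positive integers; $\varnothing$ is the empty index. Write $\boldsymbol{k}_{[1,j)}=(k_1,\dots,k_{j-1})$ and $\boldsymbol{k}_{(j,r]}=(k_{j+1},\dots,k_r)$, with $\boldsymbol{k}_{[1,1)}=\boldsymbol{k}_{(r,r]}=\varnothing$. $\mathcal T_N(\boldsymbol{k};s)=\sum_{-N<n_1<\cdots<n_r<N}\prod_{i=1}^r(n_i+s)^{-k_i}$ (sum over integers). For integers $A<B$ with $(A,B)$ containing no zero summation index (here $(A,B)=(-M,0)$ or $(0,M)$ with $M\geqslant1$) and an index $\boldsymbol{\alpha}=(\alpha_1,\dots,\alpha_d)$, put $\zeta_{(A,B)}(\boldsymbol{\alpha})=\sum_{A<n_1<\cdots<n_d<B}\prod_{i=1}^d n_i^{-\alpha_i}$ and, for $m\geqslant0$, $$\zeta_{(A,B),m}(\boldsymbol{\alpha})=\sum_{\substack{\lambda_1+\cdots+\lambda_d=m\\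 \lambda_\nu\geqslant0}}\Bigl(\prod_{\nu=1}^d\tbinom{-\alpha_\nu}{\lambda_\nu}\Bigr)\zeta_{(A,B)}(\alpha_1+\lambda_1,\dots,\alpha_d+\lambda_d),\qquad\zeta_{(A,B),m}(\varnothing)=\delta_{m,0}.$$ *)

(* Defs.v *)
From mathcomp Require Import all_boot all_order all_algebra.
From mathcomp Require Import reals complex.

Set Implicit Arguments.
Unset Strict Implicit.
Unset Printing Implicit Defensive.

Import Order.TTheory GRing.Theory Num.Theory.
Local Open Scope ring_scope.
Local Open Scope complex_scope.

Definition is_index (k : seq nat) : bool := all (fun x => (0 < x)%N) k.

Definition oint (A B : int) : seq int :=
  if A < B then [seq A + 1 + i%:Z | i <- iota 0 `|B - A|%N.-1] else [::].

Lemma mem_oint (A B n : int) : (n \in oint A B) = (A < n < B).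
Proof.
rewrite /oint; case: ifP => [ltAB | /negbT]; last first.
  rewrite -leNgt in_nil => leBA; apply/esym/negP => /andP[h1 h2].
  by move: (lt_trans h1 h2); rewrite ltNge leBA.
have -> : B = A + `|B - A|%N%:Z by rewrite gez0_abs ?subr_ge0 ?ltW // [RHS]addrC subrK.
have : (0 < `|B - A|)%N by rewrite absz_gt0 subr_eq0 gt_eqF.
rewrite [A + _ - A]addrC addKr absz_nat.
move: `|B - A|%N => [//|M] _ /=.
apply/mapP/andP => [[i + ->]|[h1 h2]].
  rewrite mem_iota /= add0n => ltiM; split; first by rewrite -addrA ltrDl.
  by rewrite -addrA ltrD2l -[1]/(1%:Z) -PoszD ltz_nat add1n ltnS.
exists `|n - A|%N.-1; last first.
  have h3 : 0 < n - A by rewrite subr_gt0.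
  have h4 : (0 < `|n - A|)%N by rewrite absz_gt0 gt_eqF.
  rewrite -addrA -[1]/(1%:Z) -PoszD add1n prednK // gez0_abs ?ltW //.
  by rewrite [RHS]addrC subrK.
have h3 : 0 < n - A by rewrite subr_gt0.
have h4 : (0 < `|n - A|)%N by rewrite absz_gt0 gt_eqF.
rewrite mem_iota /= add0n -ltnS prednK // -ltz_nat gez0_abs ?ltW //.
by rewrite ltrBlDl.
Qed.

Lemma oint_uniq (A B : int) : uniq (oint A B).
Proof.
rewrite /oint; case: ifP => // _; rewrite map_inj_uniq ?iota_uniq //.
by move=> i j /addrI [].
Qed.

Definition incr_tuples (A B : int) (r : nat) :
    {set {ffun 'I_r -> seq_sub (oint A B)}} :=
  [set n : {ffun 'I_r -> seq_sub (oint A B)} |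
    [forall i : 'I_r, forall j : 'I_r, (i < j)%N ==> (ssval (n i) < ssval (n j))]].

Section MultipleSums.

Variable R : realType.

Definition calT (N : nat) (k : seq nat) (s : R[i]) : R[i] :=
  \sum_(n in incr_tuples (- N%:Z) N%:Z (size k))
    \prod_(i < size k) ((ssval (n i))%:~R + s) ^- nth 0%N k i.

Definition zeta (A B : int) (alpha : seq nat) : R[i] :=
  \sum_(n in incr_tuples A B (size alpha))
    \prod_(i < size alpha) (ssval (n i))%:~R ^- nth 0%N alpha i.

(* Generalised binomial coefficient; it is used at x = - alpha, so 'C(_, _) on
   natural numbers does not apply. *)
Definition gbinom (x : R[i]) (l : nat) : R[i] :=
  (\prod_(i < l) (x - i%:R)) / (l`!)%:R.

(* Each part of a composition of m into nonnegative parts is at most m, so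
   lambda may be taken with values in 'I_m.+1. *)
Definition zetam (A B : int) (m : nat) (alpha : seq nat) : R[i] :=
  \sum_(lambda : {ffun 'I_(size alpha) -> 'I_m.+1}
         | (\sum_(nu < size alpha) lambda nu)%N == m)
    (\prod_(nu < size alpha) gbinom (- (nth 0%N alpha nu)%:R) (lambda nu)) *
    zeta A B [seq (nth 0 alpha nu + lambda nu)%N | nu : 'I_(size alpha)].

Lemma zeta_nil (A B : int) : zeta A B [::] = 1.
Proof.
rewrite /zeta (eq_bigr (fun=> 1)) => [|n _]; last by rewrite big_ord0.
rewrite (eq_bigl predT) => [|n]; last by rewrite inE; apply/forallP => -[].
by rewrite big_const card_ffun card_ord expn0 /= addr0.
Qed.

Lemma zetam_nil (A B : int) (m : nat) : zetam A B m [::] = (m == 0%N)%:R.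
Proof.
rewrite /zetam; have [->|m0] := eqVneq m 0%N; last first.
  by rewrite big_pred0 // => l; rewrite big_ord0 eq_sym (negbTE m0).
rewrite (eq_bigr (fun=> 1)) => [|l _]; last first.
  rewrite big_ord0 mul1r; set t := [seq _ | _ in _].
  have /size0nil -> : size t = 0%N by rewrite size_map -cardE card_ord.
  exact: zeta_nil.
rewrite (eq_bigl predT) => [|l]; last by rewrite big_ord0.
by rewrite big_const card_ffun !card_ord expn0 /= addr0.
Qed.

End MultipleSums.

(* Main.v *)
Require Import Defs.
From mathcomp Require Import all_boot all_order all_algebra.
From mathcomp Require Import reals complex.

Set Implicit Arguments.
Unset Strict Implicit.
Unset Printing Implicit Defensive.

Import Order.TTheory GRing.Theory Num.Theory.
Local Open Scope ring_scope.
Local Open Scope complex_scope.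

(** For a fixed increasing tuple n, the product of the (n_i + s)^-k_i is a
    rational function of s with poles at the -n_j only, and the theorem is its
    partial fraction decomposition summed over n.  Put e = n_j + s.  The
    remaining factors are the (n_i - n_j + e)^-k_i with i <> j, which are power
    series in e at the pole; the coefficient of e^m in their product multiplies
    e^-(k_j - m) in the decomposition.  By the binomial series this coefficient
    is a sum over compositions of m of products of binomials and powers of the
    n_i - n_j.

    Now fix the value of n_j.  The indices below j and above j range
    independently, and after translation by n_j they increase inside
    (-N - n_j, 0) and (0, N - n_j).  So the sum over n of the product of series
    factors into a left and a right series, whose coefficients are the zetam of
    the statement, and the sum over a + b = m is the Cauchy product.

    The decomposition ([partial_fractions]) is obtained from divisibility: the
    polynomial 1 - (sum of the candidate principal parts) * prod P_i has degree
    less than prod P_i and is divisible by each P_i = (X + x_i)^k_i, because the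
    principal part at -x_j inverts the other factors modulo P_j; hence it
    vanishes.  Power series are represented by polynomials modulo X^M, with
    [binser_mul] stating that the truncated binomial series inverts a power.
    The combinatorial side goes through the iterated sum [msum], which agrees
    with sums over increasing tuples ([incr_sum]) and splits at a chosen
    position ([msum_split]). *)

(** * Partial fractions from local inverses *)

Lemma dvdp_XnP (F : fieldType) (M : nat) (p : {poly F}) :
  reflect (forall l, (l < M)%N -> p`_l = 0) ('X^M %| p).
Proof.
apply: (iffP idP) => [/dvdpP[q ->] l ltlM | h]; first by rewrite coefMXn ltlM.
rewrite -(poly_take_drop M p) (_ : take_poly M p = 0) ?add0r ?dvdp_mulIr //.
by apply/polyP => l; rewrite coef_take_poly coef0; case: ifP => // /h.
Qed.

Lemma dvdp_prod_coprime (F : fieldType) (I : finType) (P : I -> {poly F})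
    (q : {poly F}) :
  (forall i j, i != j -> coprimep (P i) (P j)) -> (forall i, P i %| q) ->
  \prod_i P i %| q.
Proof.
move=> coP dvdP; rewrite -big_enum; move: (enum_uniq I).
elim: (enum I) => [|i e IHe] /=; first by rewrite big_nil dvd1p.
case/andP=> iNe ue; rewrite big_cons Gauss_dvdp ?dvdP ?IHe //.
elim: e iNe {IHe ue} => [|j e IHe]; first by rewrite big_nil coprimep1.
rewrite inE negb_or big_cons coprimepMr => /andP[ij iNe].
by rewrite coP ?IHe.
Qed.

(** V j is any polynomial that inverts, to order k j, the factors other than
    the j-th one written in the local parameter X at the pole -x j.
    Positivity of the total exponent excludes the constant 1, which has no
    decomposition without a polynomial part. *)
Lemma partial_fractions (F : fieldType) (I : finType) (x : I -> F)
    (k : I -> nat) (V : I -> {poly F}) (s : F) :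
  injective x -> (0 < \sum_i k i)%N -> (forall i, x i + s != 0) ->
  (forall j, 'X^(k j) %|
     1 - V j * \prod_(i | i != j) ('X + (x i - x j)%:P) ^+ k i) ->
  \prod_i (x i + s) ^- k i =
  \sum_j \sum_(m < k j) (V j)`_m * (1 / (x j + s) ^+ (k j - m)).
Proof.
move=> inj_x k_gt0 xs_neq0 invV.
pose P i := ('X + (x i)%:P) ^+ k i.
pose T j := take_poly (k j) (V j) \Po ('X + (x j)%:P).
(* T j is the principal part at the pole j, multiplied by P j. *)
pose Q := 1 - \sum_j T j * \prod_(i | i != j) P i.
have P0 i : P i != 0 by rewrite expf_neq0 // -size_poly_eq0 size_XaddC.
have szP i : size (P i) = (k i).+1.
  by rewrite (polySpred (P0 i)) size_exp size_XaddC mul1n.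
have szprod (p : pred I) : size (\prod_(i | p i) P i) = (\sum_(i | p i) k i).+1.
  rewrite size_prod; last by move=> i _.
  rewrite (eq_bigr (fun i => (k i + 1)%N)) => [|i _]; last by rewrite szP addn1.
  by rewrite big_split /= sum1_card -addSn addnK.
have szQ : (size Q <= \sum_i k i)%N.
  rewrite (leq_trans (size_polyD _ _)) // geq_max size_poly1 k_gt0 size_polyN.
  apply: (leq_trans (size_sum _ _ _)); apply/bigmax_leqP => j _.
  apply: (leq_trans (size_polyMleq _ _)); rewrite szprod addnS /=.
  rewrite size_comp_poly2 ?size_XaddC // [leqRHS](bigD1 j) //= leq_add2r.
  exact: size_take_poly.
(* Modulo P j every term but the j-th one vanishes; the j-th one is congruent
   to 1, as seen by substituting X + x j for X in the hypothesis on V j. *)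
have dvdQ j : P j %| Q.
  rewrite /Q (bigD1 j) //= opprD addrA dvdp_sub //; last first.
    apply: (big_ind (fun p => P j %| p)) => [||i ij]; first exact: dvdp0.
      by move=> p q; apply: dvdp_add.
    by rewrite dvdp_mull // (bigD1 j) ?dvdp_mulIl // eq_sym.
  have -> : P j = 'X^(k j) \Po ('X + (x j)%:P).
    by rewrite rmorphXn /= comp_polyX.
  have -> : \prod_(i | i != j) P i =
      (\prod_(i | i != j) ('X + (x i - x j)%:P) ^+ k i) \Po ('X + (x j)%:P).
    rewrite rmorph_prod; apply: eq_bigr => i _ /=.
    rewrite rmorphXn /= comp_polyD comp_polyX comp_polyC -addrA -polyCD.
    by rewrite [_ + (_ - _)]addrC subrK.
  rewrite -[X in X - _](comp_polyC 1 ('X + (x j)%:P)) -comp_polyM -comp_polyB.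
  apply: dvdp_comp_poly.
  move: (invV j); rewrite -{1}(poly_take_drop (k j) (V j)) mulrDl opprD addrA.
  by rewrite dvdp_addl // dvdpNr dvdp_mulr // dvdp_mulIr.
have Q0 : Q = 0.
  apply/eqP; apply: contraTT szQ => Qn0; rewrite -ltnNge.
  rewrite -ltnS -(szprod predT) ltnS; apply: dvdp_leq => //.
  apply: dvdp_prod_coprime => // i j ij.
  apply: coprimep_expl; apply: coprimep_expr.
  have negE l : 'X + (x l)%:P = 'X - (- x l)%:P by rewrite polyCN opprK.
  rewrite !negE coprimep_XsubC2 //.
  by rewrite opprK addrC subr_eq0; apply: contra ij => /eqP/inj_x->.
have hP i : (P i).[s] = (x i + s) ^+ k i.
  by rewrite /P horner_exp !hornerE addrC.
(* Evaluate Q = 0 at s and divide by the product of the P i. *)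
have := congr1 (horner^~ s) Q0; rewrite /Q !hornerE => /eqP; rewrite subr_eq0.
rewrite horner_sum => /eqP one.
rewrite -[LHS]mul1r [X in X * _]one mulr_suml; apply: eq_bigr => j _.
rewrite hornerM horner_prod [X in _ * X](bigD1 j) //= mulrACA -big_split /=.
rewrite [X in _ * X]big1 ?mulr1; last first.
  by move=> i _; rewrite hP mulfV // expf_neq0.
rewrite horner_comp !hornerE /take_poly horner_poly mulr_suml.
apply: eq_bigr => m _; rewrite -mulrA; congr (_ * _).
rewrite [s + _]addrC div1r -[X in _ * _ ^- X](subnK (ltnW (ltn_ord m))).
rewrite exprD invfM mulrCA.
by rewrite mulfV ?mulr1 // expf_neq0.
Qed.

(** * The truncated binomial series *)

Section BinomialSeries.

Variables (R : realType) (M : nat).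
Implicit Types (d : R[i]) (k l : nat).

Lemma gbinom0 l : gbinom (0 : R[i]) l = (l == 0%N)%:R.
Proof.
case: l => [|l]; first by rewrite /gbinom big_ord0 divr1.
by rewrite /gbinom big_ord_recl /= subr0 !mul0r.
Qed.

Lemma gbinom_pascal (x : R[i]) l :
  gbinom (x + 1) l.+1 = gbinom x l.+1 + gbinom x l.
Proof.
rewrite /gbinom big_ord_recl [in RHS]big_ord_recr /= subr0.
have -> : \prod_(i < l) (x + 1 - (bump 0 i)%:R) = \prod_(i < l) (x - i%:R).
  by apply: eq_bigr => i _; rewrite /bump add1n -natr1 opprD addrACA addrA addrK.
set p := \prod_(_ < l) _.
have -> : p / (l`!)%:R = p * l.+1%:R / (l.+1`!)%:R.
  rewrite factS natrM invfM mulrA mulfK //.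
  by rewrite pnatr_eq0.
rewrite -mulrDl; congr (_ / _).
by rewrite -mulrDr -natr1 addrA subrK mulrC.
Qed.

(** The expansion of (d + X)^-k in powers of X, cut off at X^M. *)
Definition binser k d : {poly R[i]} :=
  \poly_(l < M) (gbinom (- k%:R) l * d ^- (k + l)).

(** By induction on k: Pascal's rule for generalised binomials says that
    multiplying the series of exponent k + 1 by d + X gives that of exponent k,
    up to a term in X^M created by the truncation. *)
Lemma binser_mul k d : d != 0 ->
  'X^M %| 1 - binser k d * ('X + d%:P) ^+ k.
Proof.
move=> d0; elim: k => [|k IHk].
  apply/dvdp_XnP => l ltlM.
  rewrite expr0 mulr1 coefB coef_poly ltlM oppr0 gbinom0 coef1 add0n.
  by case: l ltlM => [|l] _; rewrite ?divr1 ?mul0r subrr.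
have -> : 1 - binser k.+1 d * ('X + d%:P) ^+ k.+1 =
    1 - binser k d * ('X + d%:P) ^+ k
    + (binser k d - binser k.+1 d * ('X + d%:P)) * ('X + d%:P) ^+ k.
  by rewrite mulrBl addrA subrK exprS mulrA.
rewrite dvdp_add // dvdp_mulr //; apply/dvdp_XnP => l ltlM.
rewrite mulrDr coefB coefD coefMX coefMC !coef_poly ltlM.
have -> : - k%:R = - k.+1%:R + 1 :> R[i] by rewrite -natr1 opprD subrK.
case: l ltlM => [|l] ltlM /=.
  rewrite add0r !addn0 exprS invfM mulrA -mulrA.
  by rewrite /gbinom !big_ord0 !divr1 !mul1r mulrAC mulVf // mul1r subrr.
rewrite (ltnW ltlM) gbinom_pascal addSnnS [(k.+1 + l.+1)%N]addSn exprS invfM.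
rewrite [d^-1 * _]mulrC mulrA mulfVK // [X in _ - X]addrC -mulrDl.
by rewrite subrr.
Qed.

End BinomialSeries.

(** * Sums over increasing tuples *)

Section IncreasingSums.

Variable C : comPzSemiRingType.
Implicit Types (F G : nat -> int -> C) (A B x : int).

(** The sum over A < n_0 < ... < n_(r-1) < B of the product of the F i n_i,
    organised by the smallest entry.  The length is a plain number and the
    entries are plain integers, so that intervals can be cut and translated
    without changing the type of the summation index. *)
Fixpoint msum r F A B : C :=
  if r is r'.+1 then
    \sum_(x <- oint A B) F 0%N x * msum r' (fun i => F i.+1) x B
  else 1.

Lemma eq_msum r F G A B :
  (forall i y, (i < r)%N -> F i y = G i y) -> msum r F A B = msum r G A B.
Proof.
elim: r F G A => [//|r IHr] F G A eqFG /=; apply: eq_bigr => y _.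
by rewrite eqFG //; congr (_ * _); apply: IHr => i z ltir; apply: eqFG.
Qed.

Lemma msum_shift r F A B (c : int) :
  msum r F A B = msum r (fun i y => F i (y + c)) (A - c) (B - c).
Proof.
elim: r F A => [//|r IHr] F A /=.
have -> : oint (A - c) (B - c) = [seq y - c | y <- oint A B].
  rewrite /oint ltrD2r opprB addrA subrK; case: ifP => // _.
  rewrite -map_comp; apply: eq_map => i /=.
  by rewrite [A - c + 1]addrAC [LHS]addrAC.
rewrite big_map; apply: eq_bigr => y _.
by rewrite subrK (IHr (fun i => F i.+1)).
Qed.

Lemma oint_filter_gt A B x :
  A <= x -> perm_eq [seq y <- oint A B | x < y] (oint x B).
Proof.
move=> leAx; apply: uniq_perm; rewrite ?filter_uniq ?oint_uniq // => y.
rewrite mem_filter !mem_oint.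
by case: (ltP x y) => //= ltxy; rewrite (le_lt_trans leAx ltxy).
Qed.

Lemma oint_filter_lt A B x :
  x <= B -> perm_eq [seq y <- oint A B | y < x] (oint A x).
Proof.
move=> lexB; apply: uniq_perm; rewrite ?filter_uniq ?oint_uniq // => y.
rewrite mem_filter !mem_oint andbC.
by case: (ltP y x) => //= ltyx; rewrite ?(lt_le_trans ltyx lexB) ?andbT ?andbF.
Qed.

(** Cutting an increasing sequence at its entry x of rank j: the entries before
    it lie in (A, x), those after it in (x, B), without further relation. *)
Lemma msum_split j r F A B :
  msum (j + r.+1) F A B =
  \sum_(x <- oint A B)
     F j x * msum j F A x * msum r (fun i => F (j.+1 + i)%N) x B.
Proof.
elim: j F A => [|j IHj] F A.
  by rewrite add0n /=; apply: eq_bigr => x _; rewrite mulr1.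
rewrite addSn /=.
under eq_bigr => y _ do rewrite IHj mulr_sumr.
transitivity (\sum_(y <- oint A B) \sum_(x <- oint A B | y < x)
  F 0%N y * (F j.+1 x * msum j (fun i => F i.+1) y x
     * msum r (fun i => F (j.+1 + i).+1) x B)).
  rewrite big_seq [RHS]big_seq; apply: eq_bigr => y.
  rewrite mem_oint => /andP[ltAy _].
  by rewrite -[RHS]big_filter; apply/esym/perm_big/oint_filter_gt/ltW.
rewrite (exchange_big_dep predT) //= big_seq [RHS]big_seq; apply: eq_bigr => x.
rewrite mem_oint => /andP[_ ltxB].
rewrite mulr_sumr mulr_suml -big_filter.
rewrite (perm_big _ (oint_filter_lt A (ltW ltxB))); apply: eq_bigr => y _.
by rewrite !mulrA [F 0%N y * _]mulrC.
Qed.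

Lemma big_seq_sub (T : choiceType) (s : seq T) (P : pred T) (E : T -> C) :
  uniq s -> \sum_(y <- s | P y) E y =
            \sum_(y : seq_sub s | P (ssval y)) E (ssval y).
Proof.
move=> us; rewrite -[s in LHS](val_seq_sub_enum us) big_map; apply: perm_big.
apply: uniq_perm; rewrite ?index_enum_uniq //.
  by rewrite -(map_inj_uniq val_inj) val_seq_sub_enum.
by move=> y; rewrite mem_index_enum mem_seq_sub_enum.
Qed.

Definition ffun_cons (S : finType) r (y : S) (n : {ffun 'I_r -> S}) :
    {ffun 'I_r.+1 -> S} :=
  [ffun i => oapp n y (unlift ord0 i)].

Lemma big_ffun_cons (S : finType) r (P : pred {ffun 'I_r.+1 -> S})
    (E : {ffun 'I_r.+1 -> S} -> C) :
  \sum_(n | P n) E n = \sum_y \sum_(n | P (ffun_cons y n)) E (ffun_cons y n).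
Proof.
rewrite pair_big_dep /=.
rewrite (reindex (fun p : S * {ffun 'I_r -> S} => ffun_cons p.1 p.2)) //=.
exists (fun n => (n ord0, [ffun i => n (lift ord0 i)]));
  [case=> y n _|move=> n _] => /=.
  rewrite /ffun_cons ffunE unlift_none; congr (_, _).
  by apply/ffunP => i; rewrite !ffunE liftK.
by apply/ffunP => i; rewrite !ffunE; case: unliftP => [j ->|->] //=; rewrite ffunE.
Qed.

(** The form of [incr_sum] that goes through an induction: the lower bound x
    moves while the type of the entries, attached to (A, B), stays fixed. *)
Lemma incr_sum_gt r F A B x : A <= x ->
  \sum_(n in incr_tuples A B r | [forall i, x < ssval (n i)])
     \prod_(i < r) F i (ssval (n i)) = msum r F x B.
Proof.
elim: r F x => [|r IHr] F x leAx.
  rewrite (eq_bigr (fun=> 1)) => [|n _]; last by rewrite big_ord0.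
  rewrite (eq_bigl predT) => [|n]; last first.
    by rewrite inE; apply/andP; split; apply/forallP => -[].
  by rewrite big_const card_ffun card_ord expn0 /= addr0.
rewrite big_ffun_cons /=.
rewrite -(perm_big _ (oint_filter_gt B leAx)) big_filter.
rewrite (big_seq_sub _ _ (oint_uniq A B)) [RHS]big_mkcond; apply: eq_bigr => y _ /=.
have vy : A < ssval y by have := ssvalP y; rewrite mem_oint => /andP[].
case: ifPn => ltxy; last first.
  apply: big_pred0 => n; apply/negbTE.
  apply: contra ltxy => /andP[_ /forallP/(_ ord0)].
  by rewrite ffunE unlift_none.
rewrite -(IHr _ _ (ltW vy)) mulr_sumr; apply: eq_big => [n|n _].
  rewrite !inE; apply/andP/andP => [[/forallP h /forallP hx]|[/forallP h /forallP hx]].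
    split; apply/forallP => i.
      apply/forallP => j; have /forallP/(_ (lift ord0 j)) := h (lift ord0 i).
      by rewrite !ffunE !liftK.
    have /forallP/(_ (lift ord0 i)) := h ord0.
    by rewrite !ffunE unlift_none liftK.
  split; apply/forallP => i; last first.
    rewrite ffunE; case: unliftP => [i' _|_] //=.
    by apply: lt_trans ltxy (hx i').
  apply/forallP => j; apply/implyP; rewrite !ffunE.
  case: (unliftP ord0 i) => [i'|] ->; case: (unliftP ord0 j) => [j'|] -> //=.
  rewrite /bump /= !add1n ltnS => ij.
  by have /forallP/(_ j')/implyP := h i'; apply.
rewrite big_ord_recl ffunE unlift_none /=; congr (_ * _).
by apply: eq_bigr => i _; rewrite ffunE liftK.
Qed.

Lemma incr_sum r F A B :
  \sum_(n in incr_tuples A B r) \prod_(i < r) F i (ssval (n i)) = msum r F A B.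
Proof.
rewrite -(incr_sum_gt r F B (lexx A)); apply: eq_bigl => n.
rewrite (_ : [forall i, _] = true) ?andbT //; apply/forallP => i.
by have := ssvalP (n i); rewrite mem_oint => /andP[].
Qed.

(** The condition n_j = x is turned into one more factor, an indicator at
    position j, after which [msum_split] leaves the single pivot x. *)
Lemma incr_sum_pinned r F A B x (j : 'I_r) : A < x < B ->
  \sum_(n in incr_tuples A B r | ssval (n j) == x)
     \prod_(i < r | i != j) F i (ssval (n i)) =
  msum j F A x * msum (r - j.+1) (fun i => F (j.+1 + i)%N) x B.
Proof.
move=> xAB; pose G i y := if i == j :> nat then (y == x)%:R else F i y.
transitivity (msum r G A B).
  rewrite -incr_sum big_mkcondr; apply: eq_bigr => n _.
  rewrite [in RHS](bigD1 j) //= /G eqxx; case: ifP => _; rewrite ?mul0r // mul1r.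
  by apply: eq_bigr => i /negbTE; rewrite -val_eqE => ->.
have {1}-> : r = (j + (r - j.+1).+1)%N by rewrite addnS -addSn subnKC.
rewrite msum_split (bigD1_seq x) ?mem_oint ?oint_uniq //=.
rewrite [X in _ + X]big1 ?addr0 => [|y /negbTE yx]; last first.
  by rewrite /G eqxx yx !mul0r.
rewrite {1}/G !eqxx mul1r; congr (_ * _); apply: eq_msum => i y lti.
  by rewrite /G ltn_eqF.
by rewrite /G gtn_eqF // addSn ltnS leq_addr.
Qed.

End IncreasingSums.

(** * Coefficients of products of series *)

Lemma coef_prod_low (C : comNzRingType) (I : finType) (p q : I -> {poly C}) m :
  (forall i l, (l <= m)%N -> (p i)`_l = (q i)`_l) ->
  (\prod_i p i)`_m = (\prod_i q i)`_m.
Proof.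
move=> eqpq; pose eq_low (a b : {poly C}) := forall l, (l <= m)%N -> a`_l = b`_l.
suff /(_ m (leqnn m)) : eq_low (\prod_i p i) (\prod_i q i) by [].
apply: big_ind2 => [l _|p1 q1 p2 q2 e1 e2 l lem|i _ l] //; last exact: eqpq.
rewrite !coefM; apply: eq_bigr => i _.
rewrite e1 ?e2 ?(leq_trans (leq_subr _ _) lem) //.
by apply: leq_trans lem; rewrite -ltnS.
Qed.

Lemma coef_prod_poly (C : comNzRingType) (I : finType) (u : I -> nat -> C) M m :
  (m < M)%N ->
  (\prod_i \poly_(l < M) u i l)`_m =
  \sum_(f : {ffun I -> 'I_m.+1} | (\sum_i f i)%N == m) \prod_i u i (f i).
Proof.
move=> ltmM.
rewrite (@coef_prod_low _ _ _ (fun i => \poly_(l < m.+1) u i l)); last first.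
  by move=> i l lem; rewrite !coef_poly ltnS lem (leq_ltn_trans lem).
under eq_bigr => i _ do rewrite poly_def.
rewrite bigA_distr_bigA /=.
under eq_bigr => f _ do rewrite scaler_prod prodrXr.
by rewrite coef_sumMXn.
Qed.

(** This is the origin of zetam: it is the coefficient of X^m in the sum, over
    increasing tuples, of the product of the binomial series of
    (n_i + X)^-alpha_i. *)
Lemma coef_msum_binser (R : realType) M (A B : int) m (alpha : seq nat) :
  (m < M)%N ->
  (msum (size alpha)
     (fun i y => binser M (nth 0%N alpha i) (y%:~R : R[i])) A B)`_m =
  zetam R A B m alpha.
Proof.
move=> ltmM; rewrite -incr_sum coef_sum.
under eq_bigr => n _ do rewrite coef_prod_poly //.
rewrite exchange_big /=; apply: eq_bigr => f _.
under eq_bigr => n _ do rewrite big_split /=.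
rewrite -mulr_sumr; congr (_ * _); rewrite /zeta.
set beta := [seq _ | _ in _].
have sz : size beta = size alpha by rewrite size_map -cardE card_ord.
rewrite (incr_sum (size beta) (fun i y => y%:~R ^- nth 0%N beta i)).
pose F i (y : int) : R[i] := y%:~R ^- nth 0%N beta i.
rewrite sz -[RHS](incr_sum _ F).
apply: eq_bigr => n _; apply: eq_bigr => i _; rewrite /F /beta.
by rewrite (nth_map i) -?cardE ?card_ord // nth_ord_enum.
Qed.

Lemma dvdXn_prod_inverse (F : fieldType) (I : finType) (P : pred I)
    (u p : I -> {poly F}) M :
  (forall i, P i -> 'X^M %| 1 - u i * p i) ->
  'X^M %| 1 - (\prod_(i | P i) u i) * \prod_(i | P i) p i.
Proof.
move=> h; rewrite -big_split /=.
apply: (big_ind (fun q : {poly F} => 'X^M %| 1 - q)) => //.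
  by rewrite subrr dvdp0.
move=> a b da db; have -> : 1 - a * b = (1 - a) + a * (1 - b).
  by rewrite mulrBr mulr1 addrA subrK.
by rewrite dvdp_add // dvdp_mull.
Qed.

(** * The decomposition of the truncated sum *)

Theorem theorem4p2 (R : realType) (k : seq nat) (N : nat) (s : R[i])
    (hk : is_index k) (hr : (1 <= size k)%N) (hN : (1 <= N)%N)
    (hs : forall z : int, s != z%:~R) :
  calT N k s =
  \sum_(j < size k) \sum_(m < nth 0%N k j) \sum_(n <- oint (- N%:Z) N%:Z)
    (\sum_(a < m.+1) \sum_(b < m.+1 | (a + b)%N == m)
       zetam R (- N%:Z - n) 0 a (take j k) *
       zetam R 0 (N%:Z - n) b (drop j.+1 k)) *
    (1 / (n%:~R + s) ^+ (nth 0%N k j - m)).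
Proof.
set A := - N%:Z; set B := N%:Z; set r := size k.
(* Any truncation order that is at least every k_j serves all poles at once. *)
pose M := (\sum_(i < r) nth 0 k i)%N.
have leM (j : 'I_r) : (nth 0 k j <= M)%N by rewrite /M (bigD1 j) //= leq_addr.
have M_gt0 : (0 < M)%N.
  apply: leq_trans (leM (Ordinal hr)); exact: (allP hk) (mem_nth _ _).
pose F i (y : int) := binser M (nth 0%N k i) (y%:~R : R[i]).
(* Partial fractions, for each increasing tuple separately. *)
transitivity (\sum_(j < r) \sum_(m < nth 0%N k j)
  \sum_(n in incr_tuples A B r)
   (\prod_(i < r | i != j) F i (ssval (n i) - ssval (n j)))`_m
     * (1 / ((ssval (n j))%:~R + s) ^+ (nth 0%N k j - m))).
  under [RHS]eq_bigr => j _ do rewrite exchange_big.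
  rewrite exchange_big; apply: eq_bigr => n; rewrite inE => /forallP incr_n.
  pose x i : R[i] := (ssval (n i))%:~R.
  have inj_x : injective x.
    move=> i j /intr_inj eqn; apply/val_inj/eqP; move: eqn.
    case: ltngtP => // lt_ij.
      have /forallP/(_ j)/implyP/(_ lt_ij) := incr_n i.
      by move=> /[swap] ->; rewrite ltxx.
    have /forallP/(_ i)/implyP/(_ lt_ij) := incr_n j.
    by move=> /[swap] ->; rewrite ltxx.
  rewrite (partial_fractions (V := fun j => \prod_(i < r | i != j)
      F i (ssval (n i) - ssval (n j))) inj_x) // => [i|j].
    rewrite addrC -[x i]opprK subr_eq0 /x -mulrNz; exact: hs.
  apply: dvdp_trans (dvdp_exp2l _ (leM j)) _.
  apply: dvdXn_prod_inverse => i ij; rewrite /F intrB; apply: binser_mul.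
  by rewrite subr_eq0 (inj_eq inj_x).
apply: eq_bigr => j _; apply: eq_bigr => m _.
(* The tuples are grouped by the value x of their j-th entry. *)
transitivity (\sum_(x <- oint A B)
  \sum_(n in incr_tuples A B r | ssval (n j) == x)
   (\prod_(i < r | i != j) F i (ssval (n i) - ssval (n j)))`_m
     * (1 / ((ssval (n j))%:~R + s) ^+ (nth 0%N k j - m))).
  rewrite (exchange_big_dep (mem (incr_tuples A B r))) /=; last first.
    by move=> x n _ /andP[].
  apply: eq_bigr => n n_in.
  rewrite (eq_bigl (pred1 (ssval (n j)))) => [|x]; last first.
    by rewrite /= [x == _]eq_sym; apply: andb_idl.
  have one_x := filter_pred1_uniq (oint_uniq A B) (ssvalP (n j)).
  by rewrite -[RHS]big_filter [filter _ (oint A B)]one_x big_seq1.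
rewrite big_seq [RHS]big_seq; apply: eq_bigr => x; rewrite mem_oint => xAB.
under eq_bigr => n /andP[_ /eqP ->] do [].
rewrite -mulr_suml -coef_sum; congr (_ * _).
rewrite (incr_sum_pinned (fun i y => F i (y - x))) //.
have ltmM : (m < M)%N := leq_trans (ltn_ord m) (leM j).
have left_zeta a : (a < M)%N ->
    (msum j (fun i y => F i (y - x)) A x)`_a = zetam R (A - x) 0 a (take j k).
  move=> ltaM; rewrite (msum_shift _ _ _ _ x) subrr -(coef_msum_binser _ _ _ _ ltaM).
  rewrite size_take ltn_ord; congr ((polyseq _)`_a); apply: eq_msum => i y ltij.
  by rewrite addrK /F nth_take.
have right_zeta b : (b < M)%N ->
    (msum (r - j.+1) (fun i y => F (j.+1 + i)%N (y - x)) x B)`_b =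
    zetam R 0 (B - x) b (drop j.+1 k).
  move=> ltbM; rewrite (msum_shift _ _ _ _ x) subrr -(coef_msum_binser _ _ _ _ ltbM).
  rewrite size_drop; congr ((polyseq _)`_b); apply: eq_msum => i y _.
  by rewrite addrK /F nth_drop.
rewrite coefM; apply: eq_bigr => a _.
have leam : (a <= m)%N by rewrite -ltnS.
rewrite (big_pred1 (inord (m - a))) => [|b]; last first.
  rewrite -[RHS]val_eqE /= inordK ?ltnS ?leq_subr //.
  by rewrite -(eqn_add2l a (b : nat)) subnKC.
rewrite inordK ?ltnS ?leq_subr // left_zeta ?right_zeta //.
  exact: leq_ltn_trans (leq_subr _ _) ltmM.
exact: leq_ltn_trans leam ltmM.
Qed.
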